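(* Let $A$ be a set of regular cardinals with no maximum and let $I$ be an ideal on $A$. If $A$ is progressive over $I$, then for every $\lambda\in\mathrm{pcf}_I(A)$ there exists a set $B_\lambda\subseteq A$ such that $J_{<\lambda^+}^I[A]=J_{<\lambda}^I[A]+B_\lambda$, that is, such that the ideal $J_{<\lambda^+}^I[A]$ is generated by $J_{<\lambda}^I[A]\cup\{B_\lambda\}$.
   Context: A set $B\subseteq A$ is $I$-positive if $B\notin I$. For a cardinal $\theta$, $I$ is weakly $\theta$-saturated if there is no partition of $A$ into $\theta$-many $I$-positive sets; $\mathrm{wsat}(I)$ is the least cardinal $\theta$ such that $I$ is weakly $\theta$-saturated. For a regular cardinal $\theta$, $I$ is $\theta$-indecomposable if $I$ is closed under $\subseteq$-increasing unions of length $\theta$; $I$ is $\theta$-regular if it is both weakly $\theta$-saturated and $\theta$-indecomposable (equivalently: whenever $\langle A_i:i<\theta\rangle$ is a sequence of $I$-positive sets there is $H\in[\theta]^\theta$ with $\bigcap_{i\in H}A_i\neq\emptyset$). $\mathrm{reg}(I)$ is the least regular $\theta$ such that $I$ is $\theta$-regular. $A$ is progressive over $I$ if $\mathrm{wsat}(I)<\min(A)$ and $\mathrm{reg}(I)<\min(A)$. $\prod A$ is the set of functions $f$ on $A$ with $f(a)\in a$ for all $a\in A$; for an ultrafilter $D$ over $A$, $\prod A/D$ is ordered by $f<_D g$ iff $\{a\in A:f(a)<g(a)\}\in D$, and $\mathrm{cf}(\prod A/D)$ is the cofinality of this linear order. Define $$\mathrm{pcf}_I(A)=\{\mathrm{cf}(\textstyle\prod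 A/D): D\text{ is an ultrafilter over }A\text{ disjoint from }I\}.$$ For a cardinal $\lambda$, $J_{<\lambda}^I[A]$ is the ideal of all $B\subseteq A$ such that either $B\in I$, or for every ultrafilter $D$ over $A$ disjoint from $I$ with $B\in D$, $\mathrm{cf}(\prod A/D)<\lambda$. *)

(* Defs.v *)
From mathcomp Require Import all_boot.
From mathcomp Require Import boolp wochoice classical_sets functions cardinality
  filter.

Set Implicit Arguments.
Unset Strict Implicit.
Unset Printing Implicit Defensive.

Local Open Scope classical_set_scope.
Local Open Scope card_scope.

(* A cardinal is an initial ordinal: a well-ordered type, none of whose proper
   initial segments is as large as the whole type.  The elements of the carrier
   play the role of the ordinals below the cardinal. Two cardinals are the same
   when their carriers are equinumerous. *)
Record cardinal := Cardinal {
  csort :> Type;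
  ole : rel csort;
  ole_wo : well_order ole;
  ole_initial : forall x, ~~ ([set: csort] #<= [set y | ~~ ole x y])
}.

Definition olt (k : cardinal) (x y : k) : Prop := ~~ ole y x.

Definition cle (k l : cardinal) : Prop := [set: k] #<= [set: l].
Definition ceq (k l : cardinal) : Prop := [set: k] #= [set: l].
Definition clt (k l : cardinal) : Prop := cle k l /\ ~ ceq k l.

Definition is_succ (k l : cardinal) : Prop :=
  clt k l /\ forall m, clt k m -> cle l m.

Section WellOrder.
Variables (T : Type) (R : rel T) (Rwo : well_order R).

Local Notation seg x := [set y | ~~ R x y].

Lemma wo_min (P : set T) : P !=set0 -> exists2 z, P z & forall y, P y -> R z y.
Proof.
move=> [x Px].
have [|z [[zP zmin] _]] := Rwo (A := [pred x | `[< P x >]]).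
  by exists x; rewrite inE.
exists z; first by move: zP; rewrite inE.
by move=> y Py; apply: zmin; rewrite inE.
Qed.

Lemma wo_refl x : R x x.
Proof.
have [|z -> h] := wo_min (P := [set x]); first by exists x.
exact: h.
Qed.

Lemma wo_total x y : R x y \/ R y x.
Proof.
have [|z [] -> h] := wo_min (P := [set z | z = x \/ z = y]).
- by exists x; left.
- by left; apply: h; right.
- by right; apply: h; left.
Qed.

Lemma wo_anti x y : R x y -> R y x -> x = y.
Proof.
move=> xy yx.
have [|z [_ zu]] := Rwo (A := [pred z | `[< z = x \/ z = y >]]).
  by exists x; rewrite inE; left.
rewrite -(zu x) ?(zu y) //; split.
- by rewrite inE; right.
- by move=> t; rewrite inE => -[]->//; exact: wo_refl.
- by rewrite inE; left.
- by move=> t; rewrite inE => -[]->//; exact: wo_refl.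
Qed.

Lemma wo_trans x y z : R x y -> R y z -> R x z.
Proof.
move=> xy yz.
have [|t tP h] := wo_min (P := [set t | [\/ t = x, t = y | t = z]]).
  by exists x; constructor 1.
case: tP h => -> h.
- by apply: h; constructor 3.
- have yx : R y x by apply: h; constructor 1.
  by rewrite (wo_anti xy yx).
- have zy : R z y by apply: h; constructor 2.
  by rewrite -(wo_anti yz zy).
Qed.

Lemma wo_wf : well_founded (fun x y => ~~ R y x).
Proof.
move=> x; apply: contrapT => nAx.
have [|z nAz zmin] := wo_min (P := [set z | ~ Acc (fun x y => ~~ R y x) z]).
  by exists x.
apply: nAz; constructor => y yz; apply: contrapT => nAy.
by move: yz; rewrite (zmin _ nAy).
Qed.

Lemma wo_compare (U : Type) :
  [set: T] #<= [set: U] \/ exists x, [set: U] #<= seg x.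
Proof.
have [|nosmall] := pselect (exists x, [set: U] #<= seg x); first by right.
left.
have pick x (g : forall y, ~~ R x y -> U) :
    {u | forall y (yx : ~~ R x y), g y yx <> u}.
  apply: cid; apply: contrapT => noU; apply: nosmall; exists x.
  have h u : exists y (yx : ~~ R x y), g y yx = u.
    apply: contrapT => nu; apply: noU; exists u => y yx gu.
    by apply: nu; exists y, yx.
  have /choice[f fP] : forall u, exists y : T, exists yx : ~~ R x y, g y yx = u.
    exact: h.
  have finj : {in [set: U] &, injective f}.
    move=> u v _ _ e; have [yu gu] := fP u; have [yv gv] := fP v.
    rewrite -gu -gv; move: (f u) (f v) e yu yv {gu gv} => s _ <- yu yv.
    by rewrite (bool_irrelevance yu yv).
  rewrite -(card_le_eql (inj_card_eq finj)); apply: subset_card_le.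
  by move=> _ [u _ <-]; have [yu _] := fP u.
pose F := Fix wo_wf (fun _ => U) (fun x g => sval (pick x g)).
have FE x : F x = sval (pick x (fun y _ => F y)).
  rewrite /F Fix_eq // => {}x g h gh; congr (sval (pick x _)).
  by apply: functional_extensionality_dep => y;
     apply: functional_extensionality_dep => yx; exact: gh.
have Fneq x y : ~~ R x y -> F y <> F x.
  by move=> yx; rewrite [F x]FE; exact: (svalP (pick x (fun y _ => F y)) y yx).
have Finj : {in [set: T] &, injective F}.
  move=> x y _ _ exy; have [xy|/Fneq] := boolP (R x y); last by rewrite exy.
  by have [yx|/Fneq] := boolP (R y x); [exact: wo_anti | rewrite exy].
by rewrite -(card_le_eql (inj_card_eq Finj)); exact: subset_card_le.
Qed.

End WellOrder.

Lemma not_card_le_powerset (T : Type) : ~ ([set: set T] #<= [set: T]).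
Proof.
move=> /card_leP[f].
pose g (X : set T) : T := val (f (SigSub (mem_set (I : [set: set T] X)))).
have ginj : injective g.
  move=> X Y /val_inj /(inj (f := f)) h.
  by have /(congr1 val) := h (mem_set I) (mem_set I).
pose D := [set x | exists2 X, x = g X & ~ X x].
have [DD|nDD] := pselect (D (g D)); last by apply: (nDD); exists D.
by case: (DD) => X /ginj <-; apply.
Qed.

Lemma exists_succ (k : cardinal) : exists l, is_succ k l.
Proof.
have [R Rwo] := well_ordering_principle (set k : eqType).
pose small (x : set k) := [set y | ~~ R x y] #<= [set: k].
pose S := {x : set k | small x}.
pose le (x y : S) := R (val x) (val y).
have lewo : well_order le.
  apply: antisymmetric_well_order.
    move=> x y /andP[xy yx]; apply: val_inj; exact: (wo_anti Rwo).
  move=> A [x Ax].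
  have [|_ [y Ay <-] zmin] := wo_min Rwo (P := [set val y | y in [set y | y \in A]]).
    by exists (val x), x.
  by exists y; split => // t At; apply: zmin; exists t.
have valI (A : set S) : {in A &, injective (fun s : S => val s)}.
  by move=> ? ? _ _; exact: val_inj.
have segS (x : S) : [set y | ~~ le x y] #<= [set: k].
  apply: card_le_trans (valP x : small _).
  rewrite -(card_le_eql (inj_card_eq (@valI _))); apply: subset_card_le.
  by move=> _ [y yx <-].
have nSk : ~ ([set: S] #<= [set: k]).
  move=> Sk; have [allS|] := pselect (forall x, small x).
    apply: (@not_card_le_powerset k); apply: card_le_trans Sk.
    rewrite -(card_le_eqr (inj_card_eq (@valI _))); apply: subset_card_le.
    by move=> x _; exists (exist _ x (allS x)).
  move=> /existsNP[x nx].
  have [|z nz zmin] := wo_min Rwo (P := [set x | ~ small x]); first by exists x.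
  apply: nz; apply: card_le_trans Sk.
  rewrite -(card_le_eqr (inj_card_eq (@valI _))); apply: subset_card_le.
  move=> y yz; have sy : small y.
    by apply: contrapT => /zmin; move: yz => /= /negP.
  by exists (exist _ y sy).
have leini (x : S) : ~~ ([set: S] #<= [set y | ~~ le x y]).
  by apply/negP => h; apply: nSk; exact: card_le_trans h (segS x).
exists (@Cardinal S le lewo leini); split; first split.
- have [//|[x h]] := wo_compare (ole_wo (c := k)) S.
  by case: nSk; apply: card_le_trans h _; exact: subset_card_le.
- by move=> /card_eqPle[_ /nSk].
- move=> m [km nkm]; have [//|[x h]] := wo_compare lewo m.
  by case: nkm; apply/card_eqPle; split=> //; exact: card_le_trans h (segS x).
Qed.

Definition succ (k : cardinal) : cardinal := sval (cid (exists_succ k)).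

Lemma succP (k : cardinal) : is_succ k (succ k).
Proof. exact: svalP (cid (exists_succ k)). Qed.

(* [lt] is meant to be a strict linear order. *)
Definition cofinal (T : Type) (lt : T -> T -> Prop) (S : set T) : Prop :=
  forall x, exists2 y, S y & x = y \/ lt x y.

Definition has_cofinality (T : Type) (lt : T -> T -> Prop) (k : cardinal) : Prop :=
  (exists2 S : set T, cofinal lt S & S #= [set: k]) /\
  (forall S : set T, cofinal lt S -> [set: k] #<= S).

Definition regular (k : cardinal) : Prop :=
  infinite_set [set: k] /\ has_cofinality (@olt k) k.

Section Ideals.
Variable A : Type.

(* Improper ideals are allowed, since [Jlt] below can be all of the power set. *)
Definition is_ideal (I : set (set A)) : Prop :=
  [/\ I set0,
      forall B C, I C -> B `<=` C -> I B &
      forall B C, I B -> I C -> I (B `|` C)].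

Variable I : set (set A).

Definition positive (B : set A) : Prop := ~ I B.

Definition weakly_saturated (t : cardinal) : Prop :=
  ~ exists2 P : t -> set A,
      partition [set: t] P [set: A] & forall i, positive (P i).

Definition is_wsat (t : cardinal) : Prop :=
  weakly_saturated t /\ forall s, weakly_saturated s -> cle t s.

Definition indecomposable (t : cardinal) : Prop :=
  forall X : t -> set A, (forall i, I (X i)) ->
    (forall i j, ole i j -> X i `<=` X j) -> I (\bigcup_i X i).

Definition ideal_regular (t : cardinal) : Prop :=
  [/\ regular t, weakly_saturated t & indecomposable t].

Definition is_reg (t : cardinal) : Prop :=
  ideal_regular t /\ forall s, ideal_regular s -> cle t s.

End Ideals.

Section Pcf.
(* A set of cardinals is presented as an injective family [K] indexed by [A];
   [f a \in a] for the ordinal [a] then becomes [f a : K a]. *)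
Variables (A : Type) (K : A -> cardinal).

Definition progressive (I : set (set A)) : Prop :=
  (exists2 t, is_wsat I t & forall a, clt t (K a)) /\
  (exists2 t, is_reg I t & forall a, clt t (K a)).

Definition product : Type := forall a, K a.

Section Ultraproduct.
Variable D : set (set A).

Definition eqD (f g : product) : Prop := D [set a | f a = g a].
Definition ltD (f g : product) : Prop := D [set a | olt (f a) (g a)].

Definition ultraproduct : Type := {C : set product | exists f, C = eqD f}.

Definition ultraproduct_lt (x y : ultraproduct) : Prop :=
  exists f g, [/\ sval x f, sval y g & ltD f g].

End Ultraproduct.

Variable I : set (set A).

Definition ultra_disjoint (D : set (set A)) : Prop :=
  UltraFilter D /\ D `&` I = set0.

Definition pcf (l : cardinal) : Prop :=
  exists2 D, ultra_disjoint D & has_cofinality (@ultraproduct_lt D) l.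

Definition Jlt (l : cardinal) : set (set A) :=
  [set B | I B \/
    forall D, ultra_disjoint D -> D B ->
      exists2 m, has_cofinality (@ultraproduct_lt D) m & clt m l].

End Pcf.

(* Main.v *)
(* Let theta = reg(I), a regular cardinal below all of A at which I is weakly
   saturated, so that no theta many I-positive sets are disjoint.  Hence a
   construction that removes an I-positive set from a fixed decreasing family
   at every step must stop before theta steps.  This replaces the usual
   counting of elements of A, and gives in turn, for J = J_{<lambda}: the
   lambda-directedness of the product modulo J; a sequence (f_xi) of length
   lambda, increasing modulo J and cofinal in every ultraproduct of
   cofinality lambda; and a g with {f_xi > g} in J_{<lambda^+} for all xi.
   The generator is the eventual value modulo J of {f_xi > g}.

   That these sets stabilize uses club guessing.  Let M1 < M be the two least
   elements of A; they are regular, and other elements of A only contribute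
   cofinalities > M.  The f_xi are chosen so that f_delta, for delta of
   cofinality M, dominates f_eta for all eta in a club of delta.  If there is no
   stabilization, a continuous sequence (xi_i : i < M) along which the sets grow
   is built so as to escape every union of earlier sets indexed by a guessing
   set, whenever this union lies in J + {f_xi > g} for some xi.  The guessing
   set T inside the club for sup xi_i has all its unions bounded in this way, by
   f_{sup xi_i}, so T yields theta many disjoint positive sets.  If
   lambda <= M, ultrafilters of cofinality lambda are principal. *)
Require Import Defs.
From mathcomp Require Import all_boot.
From mathcomp Require Import boolp wochoice classical_sets functions cardinality
  filter.

Set Implicit Arguments.
Unset Strict Implicit.
Unset Printing Implicit Defensive.

Local Open Scope classical_set_scope.
Local Open Scope card_scope.

(** * Well-orders and cardinals *)

Section Order.
Variable k : cardinal.
Implicit Types x y z : k.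

Lemma ole_refl x : ole x x.
Proof. exact: (wo_refl (@ole_wo k)). Qed.

Lemma ole_trans x y z : ole x y -> ole y z -> ole x z.
Proof. exact: (wo_trans (@ole_wo k)). Qed.

Lemma ole_anti x y : ole x y -> ole y x -> x = y.
Proof. exact: (wo_anti (@ole_wo k)). Qed.

Lemma nolt x y : ~ olt x y -> ole y x.
Proof. by move/negP; rewrite negbK. Qed.

Lemma ole_nolt x y : ole x y -> ~ olt y x.
Proof. by rewrite /olt => ->. Qed.

Lemma oltW x y : olt x y -> ole x y.
Proof. by have [->//|+ /negP] := wo_total (@ole_wo k) x y. Qed.

Lemma olt_le_trans x y z : olt x y -> ole y z -> olt x z.
Proof. by move=> /negP xy yz; apply/negP => /(ole_trans yz). Qed.

Lemma ole_lt_trans x y z : ole x y -> olt y z -> olt x z.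
Proof. by move=> xy /negP yz; apply/negP => zx; apply: yz; apply: ole_trans xy. Qed.

Lemma olt_trans x y z : olt x y -> olt y z -> olt x z.
Proof. by move=> xy /oltW; exact: olt_le_trans. Qed.

Lemma ole_eqVlt x y : ole x y -> x = y \/ olt x y.
Proof.
by move=> xy; have [yx|] := boolP (ole y x); [left; exact: ole_anti|right].
Qed.

Lemma olt_cases x y : [\/ olt x y, x = y | olt y x].
Proof.
have [|/nolt/ole_eqVlt[->|]] := pselect (olt x y); first by constructor 1.
  by constructor 2.
by constructor 3.
Qed.

Lemma omin (P : set k) : P !=set0 -> exists2 z, P z & forall y, P y -> ole z y.
Proof. exact: (wo_min (@ole_wo k)). Qed.

Definition omax x y := if ole x y then y else x.

Lemma omax_l x y : ole x (omax x y).
Proof. by rewrite /omax; case: ifP => // _; exact: ole_refl. Qed.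

Lemma omax_r x y : ole y (omax x y).
Proof.
by rewrite /omax; case: ifPn => [_|/oltW //]; exact: ole_refl.
Qed.

(** Transfinite recursion for a relation. The history is passed as a total function, equal to [x0]
    outside the segment; locality of [R] then lets the finished solution stand in for it. *)
Lemma wf_choice (X : Type) (x0 : X) (R : k -> (k -> X) -> X -> Prop) :
  (forall i h h' u, (forall j, olt j i -> h j = h' j) -> R i h u -> R i h' u) ->
  (forall i h, exists u, R i h u) ->
  exists f, forall i, R i f (f i).
Proof.
move=> Rloc Rex.
pose ext i (g : forall j, ~~ ole i j -> X) : k -> X :=
  fun j => if pselect (~~ ole i j) is left p then g j p else x0.
have [c cP] : {c : k -> (k -> X) -> X | forall i h, R i h (c i h)}.
  exists (fun i h => sval (cid (Rex i h))) => i h; exact: svalP (cid (Rex i h)).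
pose F := Fix (wo_wf (@ole_wo k)) (fun _ => X) (fun i g => c i (ext i g)).
have FE i : F i = c i (ext i (fun j _ => F j)).
  rewrite /F Fix_eq // => {}i g h gh; congr (c i _).
  by apply: functional_extensionality_dep => j; rewrite /ext; case: pselect.
exists F => i; rewrite [F i]FE; apply: Rloc (cP _ _) => j ji.
by rewrite /ext; case: pselect.
Qed.

(* [p i] is the state before step [i] and [q i] the state after it. *)
Lemma iterate (P : Type) (p0 : P) (le Step : P -> P -> Prop) :
  (forall p, exists q, Step p q) ->
  (forall s : k -> P, exists u, forall i, le (s i) u) ->
  exists p q : k -> P, (forall i, Step (p i) (q i)) /\
    forall i j, olt i j -> le (q i) (p j).
Proof.
move=> stepP ubP.
pose R j (h : k -> P * P) (u : P * P) :=
  Step u.1 u.2 /\ forall i, olt i j -> le (h i).2 u.1.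
have [i h h' u hh' [su lu]|j h|f fP] := @wf_choice _ (p0, p0) R.
- by split=> // j ji; rewrite -hh' //; exact: lu.
- have [u uP] := ubP (fun i => (h i).2); have [q uq] := stepP u.
  by exists (u, q); split.
- exists (fun i => (f i).1), (fun i => (f i).2); split=> [i|i j ij].
    by case: (fP i).
  by case: (fP j) => _; exact.
Qed.

End Order.

Lemma clt_ncle k l : clt k l -> ~ cle l k.
Proof. by move=> [kl nkl] lk; apply: nkl; apply/card_eqPle. Qed.

Lemma ncle_clt k l : ~ cle l k -> clt k l.
Proof.
move=> nlk; split; last by move=> /card_eqPle[].
have [//|[x lx]] := wo_compare (@ole_wo k) l.
by case: nlk; apply: card_le_trans lx _; exact: card_leT.
Qed.

Lemma cle_trans k l m : cle k l -> cle l m -> cle k m.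
Proof. exact: card_le_trans. Qed.

Lemma cle_clt_trans k l m : cle k l -> clt l m -> clt k m.
Proof.
move=> kl lm; apply: ncle_clt => mk; apply: (clt_ncle lm).
exact: cle_trans kl.
Qed.

Lemma clt_trans k l m : clt k l -> clt l m -> clt k m.
Proof. by move=> [kl _]; exact: cle_clt_trans. Qed.

Lemma clt_succ k l : clt k (succ l) <-> cle k l.
Proof.
have [lsl sl] := succP l; split=> [ksl|kl]; last exact: cle_clt_trans lsl.
by apply: contrapT => /ncle_clt /sl /(clt_ncle ksl).
Qed.

(** If some initial segment of a well-order of [T] is as large as [T], the least such segment has no
    proper segment of its own size. *)
Lemma exists_cardinal (T : Type) : exists k : cardinal, [set: k] #= [set: T].
Proof.
have [R Rwo] := well_ordering_principle {classic T}.
have [allT|] := pselect (forall x, ~~ ([set: T] #<= [set y | ~~ R x y])).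
  by exists (@Cardinal T R Rwo allT); exact: card_eqxx.
move=> /existsNP[x1 /negP]; rewrite negbK => Tx1.
have [|x Tx xmin] := wo_min Rwo (P := [set x | [set: T] #<= [set y | ~~ R x y]]).
  by exists x1.
pose S := {y | ~~ R x y}.
pose le (y z : S) := R (val y) (val z).
have lewo : well_order le.
  apply: antisymmetric_well_order.
    by move=> y z /andP[yz zy]; apply: val_inj; exact: (wo_anti Rwo).
  move=> B [y By].
  have [|_ [z Bz <-] zmin] := wo_min Rwo (P := [set val z | z in [set z | z \in B]]).
    by exists (val y), y.
  by exists z; split => // t Bt; apply: zmin; exists t.
have valI (B : set S) : {in B &, injective (fun s : S => val s)}.
  by move=> ? ? _ _; exact: val_inj.
have TS : [set: T] #<= [set: S].
  apply: card_le_trans Tx _; rewrite -(card_le_eqr (inj_card_eq (@valI _))).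
  by apply: subset_card_le => y yx; exists (exist _ y yx).
have leini (y : S) : ~~ ([set: S] #<= [set z | ~~ le y z]).
  apply/negP => Sy; suff /xmin : [set: T] #<= [set z | ~~ R (val y) z].
    by apply/negP; exact: (valP y).
  apply: card_le_trans TS _; apply: card_le_trans Sy _.
  rewrite -(card_le_eql (inj_card_eq (@valI _))); apply: subset_card_le.
  by move=> _ [z yz <-].
exists (@Cardinal S le lewo leini); apply/card_eqPle; split=> //.
by rewrite -(card_le_eql (inj_card_eq (@valI _))); exact: card_leT.
Qed.

(** Members of [P] smaller than [k0] embed in proper segments of [k0], so the choice reduces to the
    least [x] whose segment receives a member. *)
Lemma cardinal_min (P : cardinal -> Prop) :
  (exists k, P k) -> exists2 k, P k & forall l, P l -> cle k l.
Proof.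
move=> [k0 Pk0]; pose small (x : k0) l := [set: l] #<= [set y | ~~ ole x y].
have [|no] := pselect (exists x l, P l /\ small x l); last first.
  exists k0 => // l Pl; have [//|[x lx]] := wo_compare (@ole_wo k0) l.
  by case: no; exists x, l.
move=> /(omin (P := [set x | exists l, P l /\ small x l]))[x [l [Pl lx]] xmin].
exists l => // m Pm; pose S := {y | ~~ ole x y}.
have valI (B : set S) : {in B &, injective (fun s : S => val s)}.
  by move=> ? ? _ _; exact: val_inj.
pose le (y z : S) := ole (val y) (val z).
have lewo : well_order le.
  apply: antisymmetric_well_order.
    by move=> y z /andP[yz zy]; apply: val_inj; exact: ole_anti.
  move=> B [y By].
  have [|_ [z Bz <-] zmin] := omin (P := [set val z | z in [set z | z \in B]]).
    by exists (val y), y.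
  by exists z; split => // t Bt; apply: zmin; exists t.
have [Sm|[y my]] := wo_compare lewo m.
  apply: card_le_trans lx _; apply: card_le_trans Sm.
  rewrite -(card_le_eqr (inj_card_eq (@valI _))).
  by apply: subset_card_le => z zx; exists (exist _ z zx).
suff /xmin : exists l, P l /\ small (val y) l by move/negP: (valP y).
exists m; split=> //; apply: card_le_trans my _.
rewrite -(card_le_eql (inj_card_eq (@valI _))); apply: subset_card_le.
by move=> _ [z yz <-].
Qed.

Lemma card_le_injective (T U : Type) (S : set U) :
  [set: T] #<= S -> exists2 j : T -> U, (forall t, S (j t)) & injective j.
Proof.
move=> /card_leP[f]; pose c t : [set: T] := SigSub (mem_set (I : [set: T] t)).
exists (fun t => val (f (c t))) => [t|t u /val_inj].
  by have := valP (f (c t)); rewrite inE.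
by move=> /(inj (f := f)) h; have /(congr1 val) := h (mem_set I) (mem_set I).
Qed.

Lemma card_le_sig (T : Type) (P : set T) : [set: {t | P t}] #<= P.
Proof.
rewrite -(card_le_eql (inj_card_eq (f := @sval _ _) _)); last first.
  by move=> u v _ _ uv; apply: eq_sig_hprop => // ? ? ?; exact: Prop_irrelevance.
by apply: subset_card_le => _ [s _ <-]; exact: (svalP s).
Qed.

(** Regularity in the form used below. For [lambda], which is not assumed regular, it comes from
    [cofinality_bounding]. *)
Definition bounding (k : cardinal) : Prop :=
  forall (T : Type) (S : set T) (h : T -> k), ~ ([set: k] #<= S) ->
    exists x, forall t, S t -> olt (h t) x.

Section Bounding.
Variable k : cardinal.

Lemma regular_bounding : regular k -> bounding k.
Proof.
move=> [_ [_ kcof]] T S h nkS; apply: contrapT => nox; apply: nkS.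
apply: card_le_trans (card_image_le h S); apply: kcof => x.
apply: contrapT => nx; apply: nox; exists x => t St; apply: contrapT => /nolt xt.
by apply: nx; exists (h t); [exists t|exact: ole_eqVlt].
Qed.

Hypothesis kb : bounding k.

Lemma bounding_card (j : cardinal) (h : j -> k) :
  clt j k -> exists x, forall t, olt (h t) x.
Proof.
by move=> /clt_ncle/(kb h)[x xP]; exists x => t; exact: xP.
Qed.

Lemma bounding_seg (x : k) (h : k -> k) :
  exists y, forall t, olt t x -> olt (h t) y.
Proof. by apply: kb; apply/negP; exact: ole_initial. Qed.

Hypothesis kinf : infinite_set [set: k].

Lemma bounding_nomax (x : k) : exists y, olt x y.
Proof.
have [|y yP] := kb (S := [set: unit]) (fun=> x); last by exists y; exact: (yP tt).
move=> kunit; apply: kinf; apply: (card_le_finite kunit).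
exact: finite_finset.
Qed.

End Bounding.

(** * Weakly saturated ideals *)

Section Saturation.
Variables (A : Type) (I : set (set A)) (theta : cardinal).
Hypotheses (I_ideal : is_ideal I) (Isat : weakly_saturated I theta).
Hypothesis theta_inf : infinite_set [set: theta].

(** Adding the complement of the union to the set with index [i0] turns the disjoint family into a
    partition. *)
Lemma saturated_disjoint (T : Type) (S : set T) (V : T -> set A) :
  [set: theta] #<= S -> (forall t, S t -> positive I (V t)) ->
  trivIset S V -> False.
Proof.
move=> /card_le_injective[j jS jinj] Vpos Vdisj; apply: Isat.
have [i0 _] := infinite_setN0 theta_inf.
have [I0 Isub _] := I_ideal.
pose U := \bigcup_i V (j i).
pose P (i : theta) := V (j i) `|` (if pselect (i = i0) then ~` U else set0).
have VP i : V (j i) `<=` P i by move=> a; left.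
have Ppos i : positive I (P i).
  by move=> /Isub/(_ (VP i)); exact: Vpos.
exists P => //; split.
- rewrite predeqE => a; split=> // _.
  have [[i _ Via]|nU] := pselect (U a); first by exists i => //; left.
  by exists i0 => //; right; case: pselect.
- move=> i i' _ _ [a [[Va|+] [Va'|+]]].
  + apply: jinj; apply: Vdisj (jS _) (jS _) _.
    by exists a.
  + by case: pselect => // _ []; exists i.
  + by case: pselect => // _ []; exists i'.
  + by case: pselect => // i1; case: pselect => // i2 _ _; rewrite i1.
- move=> i _; apply/set0P/eqP => P0; apply: (Ppos i); rewrite P0; exact: I0.
Qed.

(* Of [theta] consecutive steps, each removing an [I]-positive set from [W],
   the removed sets would be disjoint. *)
Lemma no_long_descent (P : Type) (p0 : P) (le Step : P -> P -> Prop) :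
  (forall p, exists q, Step p q) ->
  (forall s : theta -> P, exists u, forall i, le (s i) u) ->
  (forall p q : theta -> P, (forall i, Step (p i) (q i)) ->
    exists W : P -> set A, (forall x y, le x y -> W y `<=` W x) /\
      forall i, positive I (W (p i) `\` W (q i))) -> False.
Proof.
move=> stepP ubP WP; have [p [q [pq qp]]] := iterate p0 stepP ubP.
have [W [Wanti Wpos]] := WP p q pq.
apply: (@saturated_disjoint _ setT (fun i => W (p i) `\` W (q i))) => //.
move=> i j _ _ [a [[ia nia] [ja nja]]].
by have [/qp/Wanti/(_ _ ja)|//|/qp/Wanti/(_ _ ia)] := olt_cases i j.
Qed.

End Saturation.

(** * Club guessing *)

Section Closed.
Variable M : cardinal.
Implicit Types (u v : M -> M) (x y z : M).

(* Clubs of [M] are given by functions: every club contains the nonzero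
   elements of some [closed_under u].  Keeping [0] makes floors total. *)
Definition closed_under u : set M := [set y | forall x, olt x y -> olt (u x) y].

Lemma closed_underS u v :
  (forall x, ole (u x) (v x)) -> closed_under v `<=` closed_under u.
Proof. by move=> uv y vy x xy; apply: ole_lt_trans (uv x) _; exact: vy. Qed.

Definition is_floor u x y : Prop :=
  [/\ closed_under u y, ole y x &
      forall z, closed_under u z -> ole z x -> ole z y].

(** The floor is the supremum of the closed points up to [x], and a supremum of closed points is
    closed. *)
Lemma floor_exists u x : exists y, is_floor u x y.
Proof.
pose S := [set y | forall z, closed_under u z -> ole z x -> ole z y].
have [|y Sy ymin] := omin (P := S); first by exists x.
exists y; split=> // [w wy|]; last exact: ymin.
have /existsNP[z /not_implyP[uz /not_implyP[zx /negP wz]]] : ~ S w.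
  by move=> /ymin; exact/negP.
by apply: olt_le_trans (uz _ wz) _; exact: Sy.
Qed.

(** Take the supremum of a sequence of length [theta] above [x], each term of which exceeds the
    values of [u] up to every earlier term. *)
Lemma closed_under_unbounded (theta : cardinal) u x :
  bounding theta -> infinite_set [set: theta] ->
  bounding M -> clt theta M -> exists2 y, closed_under u y & olt x y.
Proof.
move=> thb thinf Mb thM.
pose R (i : theta) (h : theta -> M) y := olt x y /\
  forall j, olt j i -> olt (h j) y /\ forall w, ole w (h j) -> olt (u w) y.
have [i h h' y hh' [xy jP]|i h|h hP] := wf_choice x (R := R).
- by split=> // j ji; rewrite -hh' //; exact: jP.
- have /choice[b bP] : forall j, exists y,
      olt (h j) y /\ forall w, ole w (h j) -> olt (u w) y.
    move=> j; have [z [hz _]] : exists z, olt (h j) z /\ True.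
      have [z zP] := bounding_card Mb (fun=> h j) thM.
      by have [i0 _] := infinite_setN0 thinf; exists z; split=> //; exact: zP i0.
    have [y yP] := bounding_seg Mb z u.
    exists (omax z y); split; first exact: olt_le_trans hz (omax_l _ _).
    move=> w wh; apply: olt_le_trans (omax_r z y); apply: yP.
    exact: ole_lt_trans hz.
  have [y yP] := bounding_card Mb (fun j => omax (b j) x) thM.
  exists y; split=> [|j ji]; first exact: ole_lt_trans (omax_r (b i) x) (yP i).
  have by_ : olt (b j) y by apply: ole_lt_trans (yP j); exact: omax_l.
  have [hb ub] := bP j; split=> [|w /ub uw]; first exact: olt_trans by_.
  exact: olt_trans by_.
have [z zP] := bounding_card Mb h thM.
have [|y yP ymin] := omin (P := [set y | forall i, olt (h i) y]); first by exists z.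
exists y; last first.
  have [i0 _] := infinite_setN0 thinf.
  by have [xh _] := hP i0; exact: olt_trans (yP i0).
move=> w wy; have [i wi] : exists i, ole w (h i).
  apply: contrapT => nw; suff /ymin : forall i, olt (h i) w by exact/negP.
  by move=> i; apply: contrapT => /nolt wi; apply: nw; exists i.
have [j ij] := bounding_nomax thb thinf i.
have [_ /(_ _ ij)[_ /(_ _ wi) uw]] := hP j.
exact: olt_trans (yP j).
Qed.

End Closed.

Section ClubGuessing.
Variables theta M1 M : cardinal.
Hypotheses (thb : bounding theta) (thinf : infinite_set [set: theta]).
Hypotheses (M1b : bounding M1) (M1inf : infinite_set [set: M1]) (Mb : bounding M).
Hypotheses (thM1 : clt theta M1) (M1M : clt M1 M).
Implicit Types (u v : M -> M) (x y z d : M).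

Definition cofinal_seq d (c : theta -> M) : Prop :=
  [/\ forall i, olt (c i) d, forall i j, ole i j -> ole (c i) (c j) &
      forall x, olt x d -> exists i, ole x (c i)].

Definition limit_closed u d : Prop :=
  forall x, olt x d -> exists y, [/\ closed_under u y, olt x y & olt y d].

(** The projection of the ladder [c] to the club given by [u]. The first conjunct discards the zero
    that [closed_under] keeps. *)
Definition floor_set u (c : theta -> M) : set M :=
  [set y | (exists x, olt x y) /\ exists i, is_floor u (c i) y].

(** A closed point between [x] and [d] lies below some [c i], whose floor is then at least that
    point. *)
Lemma floor_set_above u d c x : cofinal_seq d c -> limit_closed u d ->
  olt x d -> exists2 y, floor_set u c y & olt x y.
Proof.
move=> [_ _ cd] ud /ud[y [uy xy /cd[i yi]]].
have [z zP] := floor_exists u (c i).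
have xz : olt x z by apply: olt_le_trans xy _; case: zP => _ _; exact.
by exists z => //; split; [exists x|exists i].
Qed.

Lemma floor_set_nomax u d c y : cofinal_seq d c -> limit_closed u d ->
  floor_set u c y -> exists2 z, floor_set u c z & olt y z.
Proof.
move=> dc ud [_ [i [_ yi _]]]; apply: floor_set_above (dc) ud _.
by apply: ole_lt_trans yi _; case: dc => + _ _; exact.
Qed.

(** Fewer than [theta] floors would all lie below a single [c i], whereas some floor exceeds
    [c i]. *)
Lemma floor_set_large u d c : cofinal_seq d c -> limit_closed u d ->
  [set: theta] #<= floor_set u c.
Proof.
move=> dc ud; apply/negPn/negP => /negP small.
have [cd cmono cof] := dc.
have [i0 _] := infinite_setN0 thinf.
have /choice[h hP] : forall y, exists i, floor_set u c y -> ole y (c i).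
  by move=> y; have [[_ [i [_ yi _]]]|] := pselect (floor_set u c y);
    [exists i|exists i0].
have [i iP] := thb h small.
have [y uy] := floor_set_above dc ud (cd i).
apply: ole_nolt; apply: ole_trans (hP y uy) _.
by apply: cmono; apply: oltW; exact: iP.
Qed.

(** If the floor sets of every club fail to guess, shrink the club [M1] times, each time to one that
    witnesses the failure. At a common limit point of cofinality [theta] the floors of the ladder
    must stabilize, which contradicts one of the failures. *)
Theorem club_guessing : exists T : M -> set M, forall v, exists d,
  [/\ T d `<=` closed_under v, forall y, T d y -> exists x, olt x y,
      forall y, T d y -> exists2 z, T d z & olt y z & [set: theta] #<= T d].
Proof.
have [i0 _] := infinite_setN0 thinf; have [m0 _] := infinite_setN0 M1inf.
have [j _ _] := card_le_injective M1M.1; have x0 := j m0.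
(* One ladder [c d] is fixed for each [d] of cofinality [theta]; elsewhere its value is a dummy. *)
have /choice[c cP] : forall d, exists c,
    (exists c', cofinal_seq d c') -> cofinal_seq d c.
  move=> d; have [[c dc]|] := pselect (exists c, cofinal_seq d c); first by exists c.
  by exists (fun=> x0).
apply: contrapT => noT.
pose Step u w := (forall x, ole (u x) (w x)) /\ forall d, cofinal_seq d (c d) ->
  limit_closed u d -> ~ (floor_set u (c d) `<=` closed_under w).
have stepP u : exists w, Step u w.
  have [v vP] : exists v, forall d, cofinal_seq d (c d) -> limit_closed u d ->
      ~ (floor_set u (c d) `<=` closed_under v).
    apply: contrapT => nov; apply: noT; exists (fun d => floor_set u (c d)) => v.
    apply: contrapT => nod; apply: nov; exists v => d dc ud sub; apply: nod.
    exists d; split=> //; first by move=> y [].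
      by move=> y; exact: floor_set_nomax dc ud.
    exact: floor_set_large dc ud.
  exists (fun x => omax (u x) (v x)); split=> [x|d dc ud sub].
    exact: omax_l.
  apply: (vP d dc ud) => y /sub; apply: closed_underS => x; exact: omax_r.
have ubP (s : M1 -> M -> M) : exists w, forall i x, ole (s i x) (w x).
  have /choice[w wP] : forall x, exists y, forall i, olt (s i x) y.
    by move=> x; exact: (bounding_card Mb (fun i => s i x) M1M).
  by exists w => i x; exact/oltW.
have [p [q [pq qp]]] :=
  iterate (le := fun u v => forall x, ole (u x) (v x)) (fun=> x0) stepP ubP.
have pmono i k : ole i k -> closed_under (p k) `<=` closed_under (p i).
  move=> /ole_eqVlt[-> //|ik]; apply: closed_underS => x.
  exact: ole_trans ((pq i).1 x) (qp _ _ ik x).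
have [w wp] := ubP p.
have thM := clt_trans thM1 M1M.
(* Since [w] dominates every [p i], the supremum [d] of an increasing [theta]-sequence of points
   closed under [w] is a limit of all the clubs at once. *)
pose R (i : theta) (h : theta -> M) y :=
  closed_under w y /\ forall k, olt k i -> olt (h k) y.
have [i h h' y hh' [wy yP]|i h|e eP] := wf_choice x0 (R := R).
- by split=> // k ki; rewrite -hh' //; exact: yP.
- have [x xP] := bounding_card Mb h thM.
  have [y wy xy] := closed_under_unbounded w x thb thinf Mb thM.
  by exists y; split=> // k _; exact: olt_trans (xP k) xy.
have [d0 d0P] := bounding_card Mb e thM.
have [|d dP dmin] := omin (P := [set y | forall i, olt (e i) y]); first by exists d0.
have dcof x : olt x d -> exists i, ole x (e i).
  move=> xd; apply: contrapT => nx; suff /dmin : forall i, olt (e i) x by exact/negP.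
  by move=> i; apply: contrapT => /nolt xi; apply: nx; exists i.
have dc : cofinal_seq d (c d).
  apply: cP; exists e; split=> // i k /ole_eqVlt[->|ik]; first exact: ole_refl.
  by have [_ /(_ _ ik)/oltW] := eP k.
have accp i : limit_closed (p i) d.
  move=> x /dcof[k xk]; have [l kl] := bounding_nomax thb thinf k.
  have [wl /(_ _ kl) ekl] := eP l; exists (e l); split=> //.
    by apply: closed_underS wl.
  exact: ole_lt_trans xk ekl.
(* Floors decrease along the [p i], so each stabilizes, and [theta < M1] makes
   the stabilization uniform. *)
have /choice[s sP] : forall i : theta, exists k : M1, forall l y z, ole k l ->
    is_floor (p k) (c d i) y -> is_floor (p l) (c d i) z -> y = z.
  move=> i; pose S := [set y | exists k, is_floor (p k) (c d i) y].
  have [|y [k ky] ymin] := omin (P := S).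
    by have [y yP] := floor_exists (p m0) (c d i); exists y, m0.
  exists k => l y' z kl [y'1 y'2 y'3] lz; have := lz; case=> z1 z2 z3.
  apply: ole_anti; last by apply: y'3 => //; exact: pmono kl _ z1.
  apply: ole_trans (ymin z _); last by exists l.
  by case: ky => _ _; apply.
have [k kP] := bounding_card M1b s thM1.
have [l kl] := bounding_nomax M1b M1inf k.
(* The floors for [p k] equal those for [p l], which are closed under [q k] because [k] precedes
   [l]. This is what the step at [k] forbade. *)
have [_ /(_ d dc (accp k))] := pq k; apply=> y [_ [i iy]].
have [z zP] := floor_exists (p l) (c d i).
have [y0 y0P] := floor_exists (p (s i)) (c d i).
have y0y := sP i k y0 y (oltW (kP i)) y0P iy.
have y0z : y0 = z by apply: sP y0P zP; exact: ole_trans (oltW (kP i)) (oltW kl).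
rewrite -y0y y0z; case: zP => + _ _; apply: closed_underS => x; exact: qp.
Qed.

End ClubGuessing.

(** * Cofinalities of ultraproducts *)

Section Ultraproducts.
Variables (A : Type) (K : A -> cardinal) (I : set (set A)).
Implicit Types (D : set (set A)) (B C : set A) (f g h : product K).

(** For an ultrafilter [D], this says that the cofinality of the ultraproduct is at most the size of
    [T], in terms of representatives instead of classes. *)
Definition dominated D (T : Type) : Prop :=
  exists h : T -> product K, forall g, exists t, D [set a | ole (g a) (h t a)].

Lemma ultraC D B : UltraFilter D -> ~ D B -> D (~` B).
Proof. by move=> DU nDB; have [] := in_ultra_setVsetC B DU. Qed.

Lemma proper_notC D B : ProperFilter D -> D (~` B) -> ~ D B.
Proof.
move=> DF DC DB; apply: (filter_not_empty D).
by rewrite -(setICr B); exact: filterI.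
Qed.

Lemma ultraU D B C : UltraFilter D -> D (B `|` C) -> D B \/ D C.
Proof.
move=> DU DBC; have [|DnB] := in_ultra_setVsetC B DU; [by left|right].
by apply: filterS (filterI DBC DnB) => a [[]].
Qed.

Variable g0 : product K.

Lemma dominated_le D (T U : Type) :
  [set: T] #<= [set: U] -> dominated D T -> dominated D U.
Proof.
move=> /card_le_injective[j _ jinj] [h hP].
exists (fun u =>
  if pselect (exists t, j t = u) is left p then h (sval (cid p)) else g0).
move=> g; have [t tP] := hP g; exists (j t); case: pselect => [p|[]]; last by exists t.
by case: cid => t' /= /jinj ->.
Qed.

Lemma cofinality_dominated D (m : cardinal) : Filter D ->
  has_cofinality (@ultraproduct_lt A K D) m -> dominated D m.
Proof.
move=> DF [[S Scof /card_eqPle[Sm _]] _].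
have eqDD f : eqD D f f by apply: (filterS _ filterT) => a _.
pose cls f : ultraproduct K D := exist _ (eqD D f) (ex_intro _ f erefl).
have /pfcard_geP[S0|[F]] := Sm.
  by have [y] := Scof (cls g0); rewrite S0.
have /choice[h hP] : forall i : m, exists f, sval (F i) = eqD D f.
  by move=> i; exact: (svalP (F i)).
exists h => g; have [y Sy gy] := Scof (cls g).
have [i _ iy] := surj (f := F) Sy; exists i.
case: gy => [gy|[f [f' [/= gf yf' ff']]]].
  have : eqD D g (h i) by have /(congr1 sval)/= -> := gy; rewrite -iy hP; exact: eqDD.
  by apply: filterS => a /= ->; exact: ole_refl.
move: yf'; rewrite -iy hP => hf'.
apply: filterS (filterI (filterI gf hf') ff') => a [[/= -> ->]]; exact: oltW.
Qed.

(** Take the least size of a cofinal set. The classes of a dominating family are cofinal, since an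
    ultrafilter decides between equality and strict inequality. *)
Lemma exists_cofinality D : UltraFilter D ->
  exists2 m, has_cofinality (@ultraproduct_lt A K D) m &
    forall T : Type, dominated D T -> [set: m] #<= [set: T].
Proof.
move=> DU; set lt := @ultraproduct_lt A K D.
pose P (k : cardinal) := exists2 S, cofinal lt S & S #= [set: k].
have exP S : cofinal lt S -> exists2 k, P k & [set: k] #= S.
  move=> Scof; have [k kS] := exists_cardinal S; exists k; first exists S => //.
    by rewrite card_eq_sym; apply: card_eq_trans kS _; exact: card_setT.
  by apply: card_eq_trans kS _; exact: card_setT.
have [|m Pm mmin] := cardinal_min (P := P).
  have [|k] := exP setT; last by exists k.
  by move=> x; exists x => //; left.
have mcof S : cofinal lt S -> [set: m] #<= S.
  move=> /exP[k /mmin mk /card_eqPle[kS _]]; exact: card_le_trans kS.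
exists m => // T [h hP].
pose cls f : ultraproduct K D := exist _ (eqD D f) (ex_intro _ f erefl).
apply: card_le_trans (card_image_le (fun t => cls (h t)) setT); apply: mcof.
move=> x; have [f xf] := svalP x; have [t Dt] := hP f.
exists (cls (h t)); first by exists t.
have eqDD g : eqD D g g by apply: (filterS _ filterT) => a _.
have : D ([set a | f a = h t a] `|` [set a | olt (f a) (h t a)]).
  by apply: filterS Dt => a /= /ole_eqVlt.
move=> /ultraU[ft|ft]; [left|right].
  apply: eq_sig_hprop => [?|]; first exact: Prop_irrelevance.
  rewrite xf; apply/predeqP => g /=; split=> Dg.
    by apply: filterS (filterI ft Dg) => a /= [<-].
  by apply: filterS (filterI ft Dg) => a /= [->].
by exists f, (h t); split=> [||//]; [rewrite xf|]; exact: eqDD.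
Qed.

Definition dominated_lt (l : cardinal) D : Prop :=
  exists2 m : cardinal, clt m l & dominated D m.

(** The case that [B] is in [I] is absorbed, as no ultrafilter disjoint from [I] then contains
    [B]. *)
Lemma Jlt_dominated l B : Jlt K I l B <->
  forall D, ultra_disjoint I D -> D B -> dominated_lt l D.
Proof.
split=> [[IB|JB] D DI DB|JB].
- by have : (D `&` I) B by []; rewrite DI.2.
- have [DU _] := DI; have [m mD ml] := JB D DI DB.
  by exists m => //; exact: cofinality_dominated mD.
- right=> D DI DB; have [m ml mD] := JB D DI DB.
  have [k kcof kmin] := exists_cofinality DI.1.
  by exists k => //; apply: cle_clt_trans ml; exact: kmin.
Qed.

Lemma dominated_lt_succ l D : dominated_lt (succ l) D <-> dominated D l.
Proof.
split=> [[m /clt_succ ml]|Dl]; first exact: dominated_le.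
by exists l => //; apply/clt_succ; exact: card_lexx.
Qed.

Lemma Jlt_ideal l : is_ideal (Jlt K I l).
Proof.
split.
- by apply/Jlt_dominated => D [DU _] /filter_not_empty.
- move=> B C /Jlt_dominated JC BC; apply/Jlt_dominated => D DI DB.
  by apply: JC => //; have [DU _] := DI; exact: filterS DB.
- move=> B C /Jlt_dominated JB /Jlt_dominated JC; apply/Jlt_dominated => D DI.
  by have [DU _] := DI; move=> /ultraU[]; [exact: JB|exact: JC].
Qed.

End Ultraproducts.

(** * Sequences modulo the ideal *)

Section Generators.
Variables (A : Type) (K : A -> cardinal) (I : set (set A)) (theta : cardinal).
Hypotheses (I_ideal : is_ideal I) (Isat : weakly_saturated I theta).
Hypotheses (thb : bounding theta) (thinf : infinite_set [set: theta]).
Hypotheses (Kb : forall a, bounding (K a)) (Kinf : forall a, infinite_set [set: K a]).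
Hypothesis thK : forall a, clt theta (K a).
Implicit Types (D : set (set A)) (B C : set A) (g h : product K).

Lemma product_inhabited : exists g : product K, True.
Proof.
exists (fun a => sval (cid (infinite_setN0 (@Kinf a)))) => //.
Qed.

Lemma product_succ g : exists h, forall a, olt (g a) (h a).
Proof.
have H a : exists y, olt (g a) y := bounding_nomax (@Kb a) (@Kinf a) (g a).
by exists (fun a => sval (cid (H a))) => a; exact: svalP (cid (H a)).
Qed.

Lemma product_sup (T : cardinal) (s : T -> product K) :
  exists g, forall a, clt T (K a) -> forall t, ole (s t a) (g a).
Proof.
have H a : exists y, clt T (K a) -> forall t, ole (s t a) y.
  have [Ta|] := pselect (clt T (K a)).
    have [y yP] := bounding_card (@Kb a) (fun t => s t a) Ta.
    by exists y => _ t; exact/oltW.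
  by have [y _] := infinite_setN0 (@Kinf a); exists y.
by exists (fun a => sval (cid (H a))) => a; exact: svalP (cid (H a)).
Qed.

Definition product_max g h : product K := fun a => omax (g a) (h a).

Lemma ultra_positive D B : ultra_disjoint I D -> D B -> positive I B.
Proof. by move=> [_ DI] DB IB; have : (D `&` I) B by []; rewrite DI. Qed.

(** If [g] fails for some [D], replace it by its maximum with a bound for that [D]. Iterated [theta]
    times, with [z] in [Y] above all indices of failure, each replacement removes a set of [D],
    hence an [I]-positive set, from the points where [f z] exceeds the current [g]. *)
Lemma uniform_bound (L : cardinal) (Y : set L) (f : L -> product K)
    (DD : set (set (set A))) :
  (forall s : theta -> L, (forall i, Y (s i)) ->
    exists2 z, Y z & forall i, ole (s i) z) ->
  (forall D, DD D -> [/\ ultra_disjoint I D,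
    forall y z, Y y -> Y z -> ole y z -> D [set a | ole (f y a) (f z a)] &
    exists g, forall y, Y y -> ~ D [set a | ole (g a) (f y a)]]) ->
  exists g, forall D y, DD D -> Y y -> D [set a | ole (f y a) (g a)].
Proof.
move=> Ycof DP; apply: contrapT => nog.
pose Step g g' := (forall a, ole (g a) (g' a)) /\ exists D y,
  [/\ DD D, Y y, D [set a | olt (g a) (f y a)] &
      forall z, Y z -> D [set a | ole (f z a) (g' a)]].
have [g0 _] := product_inhabited.
apply: (no_long_descent I_ideal Isat thinf g0 (Step := Step)
  (le := fun g g' => forall a, ole (g a) (g' a))).
- move=> g; have [D [y [DDD Yy Dy]]] : exists D y,
      [/\ DD D, Y y & ~ D [set a | ole (f y a) (g a)]].
    apply: contrapT => nDy; apply: nog; exists g => D y DDD Yy.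
    by apply: contrapT => nD; apply: nDy; exists D, y.
  have [DI _ [h hP]] := DP D DDD; have [DU _] := DI.
  exists (product_max g h); split=> [a|]; first exact: omax_l.
  exists D, y; split=> // [|z Yz].
    have /ultraC := Dy; by apply: filterS => a /= /negP.
  have /ultraC := hP z Yz; apply: filterS => a /= /negP fzh.
  exact: ole_trans (oltW fzh) (omax_r _ _).
- by move=> s; have [g gP] := product_sup s; exists g => i a; exact: gP.
move=> p q pq; have [D /choice[y DyP]] := choice (fun i => (pq i).2).
have [i|z Yz yz] := Ycof y; first by case: (DyP i).
exists (fun g => [set a | olt (g a) (f z a)]); split=> [g h gh a|i].
  exact: ole_lt_trans.
have [DDD Yy Dy Dq] := DyP i; have [DI Dmono _] := DP _ DDD; have [DU _] := DI.
apply: (ultra_positive DI).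
apply: filterS (filterI (filterI (Dmono _ _ Yy Yz (yz i)) Dy) (Dq z Yz)) => a /=.
move=> [[yza pya] qza]; split; first exact: olt_le_trans pya yza.
exact: ole_nolt.
Qed.

(** * Directedness modulo the ideal of sets of cofinality below [lambda] *)

Variable lambda : cardinal.
Hypothesis lb : bounding lambda.
Implicit Types (y z : lambda).

Definition big D : Prop := ultra_disjoint I D /\ ~ dominated_lt K lambda D.

(** The filter dual to [Jlt K I lambda], by [Jlt_full]. *)
Definition full B : Prop := forall D, big D -> D B.

Lemma fullS B C : B `<=` C -> full B -> full C.
Proof. by move=> BC fB D bD; have [[DU _] _] := bD; apply: filterS BC _; exact: fB. Qed.

Lemma Jlt_full B : Jlt K I lambda B <-> full (~` B).
Proof.
have [g0 _] := product_inhabited; split=> [/(Jlt_dominated I g0) JB D [DI Dn]|fB].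
  by have [DU _] := DI; apply: ultraC => DB; apply: Dn; exact: JB.
apply/(Jlt_dominated I g0) => D DI DB; apply: contrapT => Dn.
by have [DU _] := DI; exact: proper_notC (fB D (conj DI Dn)) DB.
Qed.

(** Induction on [x]. If every [theta]-sequence below [x] is bounded below [x], then [uniform_bound]
    applies; otherwise some [theta]-sequence is cofinal in [x], and a pointwise supremum along it
    suffices. *)
Lemma directed (x : lambda) (f : lambda -> product K) :
  exists g, forall y, olt y x -> full [set a | ole (f y a) (g a)].
Proof.
have [g0 _] := product_inhabited.
pose S := [set x | ~ forall f : lambda -> product K,
  exists g, forall y, olt y x -> full [set a | ole (f y a) (g a)]].
apply: contrapT => nog; have [|{nog}x Sx xmin] := omin (P := S).
  by exists x => /(_ f).
apply: Sx => {}f; apply: contrapT => nog.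
have IH y F : olt y x ->
    exists g, forall z, olt z y -> full [set a | ole (F z a) (g a)].
  move=> yx; have /contrapT : ~ S y by move=> /xmin /ole_nolt.
  exact.
(* The induction hypothesis allows [f] to be enlarged to an [F] that is increasing modulo the ideal
   below [x]. *)
pose R y (h : lambda -> product K) u := olt y x ->
  (forall a, ole (f y a) (u a)) /\
  forall z, olt z y -> full [set a | ole (h z a) (u a)].
have [y h h' u hh' Rh yx|y h|F FP] := wf_choice g0 (R := R).
- have [fu hu] := Rh yx; split=> // z zy; rewrite -hh' //; exact: hu.
- have [yx|nyx] := pselect (olt y x); last by exists g0.
  have [u uP] := IH y h yx; exists (product_max (f y) u) => _.
  split=> [a|z /uP]; first exact: omax_l.
  by apply: fullS => a /= hu; exact: ole_trans hu (omax_r _ _).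
have Fmono y z : olt z x -> ole y z -> full [set a | ole (F y a) (F z a)].
  move=> zx /ole_eqVlt[-> D [[DU _] _]|yz].
    by apply: (filterS _ filterT) => a _; exact: ole_refl.
  by case: (FP z zx) => _; exact.
have [xcof|] := pselect (forall s : theta -> lambda, (forall i, olt (s i) x) ->
    exists2 z, olt z x & forall i, ole (s i) z).
- have [D bD|g gP] := @uniform_bound lambda [set y | olt y x] F big xcof.
    have [DI Dn] := bD; have [DU _] := DI.
    split=> // [y z yx zx yz|]; first exact: Fmono.
    (* Without a bound modulo [D], the functions [F y] for [y] below [x] would be cofinal, making
       the cofinality smaller than [lambda]. *)
    apply: contrapT => ng; apply: Dn.
    have [m mcof mmin] := exists_cofinality K DU.
    have /mmin mx : dominated K D {y | olt y x}.
      exists (fun s => F (sval s)) => g; apply: contrapT => ny; apply: ng.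
      exists g => y yx Dy.
      by apply: ny; exists (exist _ y yx).
    exists m; last exact: cofinality_dominated mcof.
    apply: ncle_clt => /card_le_trans/(_ mx)/card_le_trans/(_ (card_le_sig _)).
    exact/negP/ole_initial.
  apply: nog; exists g => y yx D bD; have [[DU _] _] := bD.
  apply: filterS (gP D y bD yx) => a /= Fg.
  by apply: ole_trans Fg; case: (FP y yx).
move=> /existsNP[s /not_implyP[sx scof]].
have [g gP] := product_sup (fun i => F (s i)).
apply: nog; exists g => y yx.
have [i yi] : exists i, olt y (s i).
  apply: contrapT => ni; apply: scof; exists y => // i.
  by apply: nolt => yi; apply: ni; exists i.
apply: fullS (Fmono _ _ (sx i) (oltW yi)) => a /= yia.
apply: ole_trans ((FP y yx).1 a) _; apply: ole_trans yia _; exact: gP.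
Qed.

Lemma not_dominated_big D : ultra_disjoint I D -> ~ dominated K D lambda -> big D.
Proof.
have [g0 _] := product_inhabited.
move=> DI nD; split=> // -[m [mlambda _] Dm]; apply: nD.
exact: dominated_le Dm.
Qed.

(** * Obedient sequences and the generator above [M] *)

Variables M1 M : cardinal.
Hypotheses (M1b : bounding M1) (M1inf : infinite_set [set: M1]) (Mb : bounding M).
Hypotheses (thM1 : clt theta M1) (M1M : clt M1 M) (Mlambda : clt M lambda).
Hypothesis Kfull : full [set a | clt M (K a)].
Implicit Types (i j : M) (x : M -> lambda) (f : lambda -> product K).

Definition normal x : Prop :=
  (forall i j, olt i j -> olt (x i) (x j)) /\
  forall i, (exists j, olt j i) ->
    (forall j, olt j i -> exists2 l, olt j l & olt l i) ->
    forall y, olt y (x i) -> exists2 j, olt j i & ole y (x j).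

Definition is_sup x y : Prop :=
  (forall i, olt (x i) y) /\ forall z, olt z y -> exists i, ole z (x i).

Lemma normal_ole x i j : normal x -> ole i j -> ole (x i) (x j).
Proof. by move=> [xmono _] /ole_eqVlt[->|/xmono/oltW//]; exact: ole_refl. Qed.

Lemma theta_lt_M : clt theta M.
Proof. exact: clt_trans thM1 M1M. Qed.

Lemma theta_lt_lambda : clt theta lambda.
Proof. exact: clt_trans theta_lt_M Mlambda. Qed.

Lemma M_infinite : infinite_set [set: M].
Proof. by move=> /(card_le_finite M1M.1). Qed.

(** The function [v] tells where each sequence has overtaken the other. At a nonzero point closed
    under [v] both values are suprema of interleaved sequences. *)
Lemma normal_agree x x' y : normal x -> normal x' -> is_sup x y -> is_sup x' y ->
  exists v : M -> M, forall i, (exists j, olt j i) -> closed_under v i -> x i = x' i.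
Proof.
move=> xN x'N [xy ysup] [x'y y'sup].
have /choice[v vP] : forall i, exists j,
    [/\ olt i j, ole (x i) (x' j) & ole (x' i) (x j)].
  move=> i; have [j1 j1P] := y'sup _ (xy i); have [j2 j2P] := ysup _ (x'y i).
  have [j ij] := bounding_nomax Mb M_infinite i.
  exists (omax j (omax j1 j2)); split.
  - exact: olt_le_trans ij (omax_l _ _).
  - apply: ole_trans j1P _; apply: normal_ole => //.
    exact: ole_trans (omax_l _ _) (omax_r _ _).
  - apply: ole_trans j2P _; apply: normal_ole => //.
    exact: ole_trans (omax_r _ _) (omax_r _ _).
exists v => i i0 vi.
have ilim j : olt j i -> exists2 l, olt j l & olt l i.
  by move=> ji; exists (v j); [case: (vP j)|exact: vi].
have [lt|//|lt] := olt_cases (x i) (x' i).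
  have [j ji xj] := x'N.2 i i0 ilim _ lt.
  have [_ _ xvj] := vP j.
  by case: (ole_nolt (ole_trans xj xvj)); apply: xN.1; exact: vi.
have [j ji xj] := xN.2 i i0 ilim _ lt.
have [_ xvj _] := vP j.
by case: (ole_nolt (ole_trans xj xvj)); apply: x'N.1; exact: vi.
Qed.

Lemma normal_sup x : normal x -> exists y, is_sup x y.
Proof.
move=> xN; have [y0 y0P] := bounding_card lb x Mlambda.
have [|y yP ymin] := omin (P := [set y | forall i, olt (x i) y]); first by exists y0.
exists y; split=> // z zy; apply: contrapT => nz.
suff /ymin/ole_nolt : forall i, olt (x i) z by [].
by move=> i; apply: contrapT => /nolt zi; apply: nz; exists i.
Qed.

(** The second clause is pointwise, not modulo the ideal, so that it passes to unions over many
    [i]. *)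
Definition obedient f : Prop :=
  (forall y z, ole y z -> full [set a | ole (f y a) (f z a)]) /\
  forall x, normal x -> exists y (v : M -> M), forall i, (exists j, olt j i) ->
    closed_under v i -> forall a, clt M (K a) -> ole (f (x i) a) (f y a).

(** At each supremum [y] of a normal sequence it is enough to dominate along one such sequence
    [e y], since any other agrees with it on a club. There are [M] many functions to dominate, so
    this is possible at the coordinates above [M]. *)
Lemma obedient_above (h : lambda -> product K) :
  exists2 f, obedient f & forall y a, ole (h y a) (f y a).
Proof.
have [g0 _] := product_inhabited.
have /choice[e eP] : forall y, exists x, (exists x', normal x' /\ is_sup x' y) ->
    normal x /\ is_sup x y.
  move=> y; have [[x xP]|n] := pselect (exists x', normal x' /\ is_sup x' y).
    by exists x.
  (* This default makes the premise [olt (e y i) y] of the third clause of [R] false. *)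
  by exists (fun=> y).
pose R y (F : lambda -> product K) u := [/\ forall a, ole (h y a) (u a),
  forall z, olt z y -> full [set a | ole (F z a) (u a)] &
  forall i, olt (e y i) y -> forall a, clt M (K a) -> ole (F (e y i) a) (u a)].
have [y F F' u FF' [R1 R2 R3]|y F|f fP] := wf_choice g0 (R := R).
- by split=> // [z zy|i iy]; rewrite -FF' //; [exact: R2|exact: R3].
- have [u1 u1P] := directed y F.
  have [u2 u2P] := product_sup (fun i => F (e y i)).
  exists (product_max (h y) (product_max u1 u2)); split=> [a|z zy|i iy a Ma].
  + exact: omax_l.
  + apply: fullS (u1P z zy) => a /= /ole_trans; apply.
    exact: ole_trans (omax_l _ _) (omax_r _ _).
  + apply: ole_trans (u2P a Ma i) _.
    exact: ole_trans (omax_r _ _) (omax_r _ _).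
exists f; last by move=> y; case: (fP y).
split=> [y z /ole_eqVlt[->|yz]|x xN].
- by move=> D [[DU _] _]; apply: (filterS _ filterT) => a _; exact: ole_refl.
- by have [_ R2 _] := fP z; exact: R2.
have [y xy] := normal_sup xN; have [|eN ey] := eP y; first by exists x.
have [v vP] := normal_agree xN eN xy ey; exists y, v => i i0 vi a Ma.
by rewrite vP //; have [_ _ R3] := fP y; apply: R3 => //; case: ey.
Qed.

Definition universal f : Prop :=
  forall D, big D -> dominated K D lambda ->
    forall g, exists y, D [set a | olt (g a) (f y a)].

(** If an obedient [p] is bounded modulo some [D] of cofinality [lambda], pass to an obedient [q]
    above it that is cofinal modulo [D]. This cannot be repeated [theta] times. *)
Lemma exists_universal : exists2 f, obedient f & universal f.
Proof.
have [g0 _] := product_inhabited.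
apply: contrapT => nof; pose P := {f | obedient f}.
have above (h : lambda -> product K) :
    exists p : P, forall y a, ole (h y a) (sval p y a).
  by have [f fO hf] := obedient_above h; exists (exist _ f fO).
have [p0 _] := above (fun=> g0).
pose le (p q : P) := forall y a, ole (sval p y a) (sval q y a).
pose Step (p q : P) := le p q /\ exists D g, [/\ big D,
  forall y, D [set a | ole (sval p y a) (g a)] &
  forall h, exists y, D [set a | olt (h a) (sval q y a)]].
apply: (no_long_descent I_ideal Isat thinf p0 (le := le) (Step := Step)).
- move=> p; have [D [bD [h hD] [g gP]]] : exists D, [/\ big D, dominated K D lambda &
      exists g, forall y, ~ D [set a | olt (g a) (sval p y a)]].
    apply: contrapT => nD; apply: nof; exists (sval p); first exact: svalP.
    move=> D bD Ddom g; apply: contrapT => ng; apply: nD; exists D; split=> //.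
    by exists g => y Dy; apply: ng; exists y.
  have [[DU _] _] := bD.
  have /choice[h' h'P] : forall y, exists u : product K, forall a,
      olt (h y a) (u a) /\ ole (sval p y a) (u a).
    move=> y; have [u uP] := product_succ (h y).
    exists (product_max u (sval p y)) => a; split; last exact: omax_r.
    exact: olt_le_trans (uP a) (omax_l _ _).
  have [q qP] := above h'; exists q; split=> [y a|].
    by apply: ole_trans (qP y a); case: (h'P y a).
  exists D, g; split=> // [y|g'].
    by have /ultraC := gP y; apply: filterS => a /=; exact: nolt.
  have [y Dy] := hD g'; exists y; apply: filterS Dy => a /= gh.
  apply: ole_lt_trans gh _; apply: olt_le_trans (qP y a); by case: (h'P y a).
- move=> s; have /choice[h hP] : forall y, exists g, forall (t : theta) a,
      ole (sval (s t) y a) (g a).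
    move=> y; have [g gP] := product_sup (fun t => sval (s t) y).
    by exists g => t a; exact: gP.
  have [q qP] := above h; exists q => t y a; exact: ole_trans (hP y t a) (qP y a).
move=> p q pq; have [D DP] := choice (fun t : theta => (pq t).2).
have [g gP] := choice DP.
(* [H] dominates all the bounds [g t], and from index [z] on every [q t] exceeds [H] modulo [D t];
   so the set where the sequence at [z] stays below [H] loses a positive set at each step. *)
have [H HP] := product_sup g.
have /choice[y yP] : forall t, exists y, D t [set a | olt (H a) (sval (q t) y a)].
  by move=> t; have [_ _] := gP t; exact.
have [z zP] := bounding_card lb y theta_lt_lambda.
exists (fun r => [set a | ole (sval r z a) (H a)]); split=> [r r' rr' a|t].
  exact: ole_trans.
have [bD Dp _] := gP t; have [DI _] := bD; have [DU _] := DI.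
apply: (ultra_positive DI).
have qyz := (svalP (q t)).1 _ _ (oltW (zP t)) (D t) bD.
apply: filterS (filterI (filterI (Dp z) qyz) (yP t)) => a /= [[pz qz] Hq]; split.
  by apply: ole_trans pz _; exact: HP.
by move=> qH; apply: (ole_nolt qH); exact: olt_le_trans Hq qz.
Qed.

(** Modulo an ultrafilter of cofinality above [lambda], the [lambda] many [f y] are bounded;
    [uniform_bound] makes the bound independent of the ultrafilter. *)
Lemma seminormal f : obedient f -> exists g, forall D y, ultra_disjoint I D ->
  ~ dominated K D lambda -> D [set a | ole (f y a) (g a)].
Proof.
move=> [fmono _].
have [s _|D [DI Dn]|g gP] := @uniform_bound lambda setT f
    [set D | ultra_disjoint I D /\ ~ dominated K D lambda].
- have [y yP] := bounding_card lb s theta_lt_lambda.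
  by exists y => // i; exact/oltW.
- split=> // [y z _ _ yz|]; first exact: fmono (not_dominated_big DI Dn).
  apply: contrapT => ng; apply: Dn; exists f => g; apply: contrapT => ny.
  by apply: ng; exists g => y _ Dy; apply: ny; exists y.
- by exists g => D y DI Dn; exact: gP.
Qed.

(** Otherwise the sets [b y] keep growing modulo the ideal, and a guessing set for a club of [M]
    selects [theta] many disjoint positive increments. *)
Lemma stabilization f g : obedient f -> exists y, forall z,
  Jlt K I lambda ([set a | olt (g a) (f z a)] `\` [set a | olt (g a) (f y a)]).
Proof.
move=> [fmono fsup]; pose b y := [set a | olt (g a) (f y a)].
have [_ Jsub JU] := Jlt_ideal I g lambda.
have bmono y z : ole y z -> Jlt K I lambda (b y `\` b z).
  move=> yz; apply/Jlt_full; apply: fullS (fmono y z yz) => a /= fyz [gy] ngz.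
  by apply: ngz; exact: olt_le_trans gy fyz.
apply: contrapT => nostab.
have [l0 _] := infinite_setN0 M_infinite.
have [j0 _ _] := card_le_injective Mlambda.1.
have [T TP] := club_guessing thb thinf M1b M1inf Mb thM1 M1M.
(* [Z C] is a stage from which on no [b w] is covered by [C], as long as [C] is covered by some
   [b y], both modulo the ideal. *)
have /choice[Z ZP] : forall C, exists z, forall w, ole z w ->
    (exists y, Jlt K I lambda (C `\` b y)) -> ~ Jlt K I lambda (b w `\` C).
  move=> C.
  have [[y Cy]|nC] := pselect (exists y, Jlt K I lambda (C `\` b y)); last first.
    by exists (j0 l0) => w _ /nC.
  have [z nz] : exists z, ~ Jlt K I lambda (b z `\` b y).
    apply: contrapT => nz; apply: nostab; exists y => z.
    by apply: contrapT => ?; apply: nz; exists z.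
  exists z => w zw _ Jw; apply: nz.
  apply: Jsub (JU _ _ (bmono z w zw) (JU _ _ Jw Cy)) _ => a [bz nby].
  have [bw|nbw] := pselect (b w a); last by left.
  by right; have [Ca|nCa] := pselect (C a); [right|left].
pose c i d (x : M -> lambda) := [set a | exists j, [/\ T d j, ole j i & b (x j) a]].
pose S i (x : M -> lambda) : set lambda :=
  [set y | forall j, olt j i -> olt (x j) y /\ forall d, ole (Z (c j d x)) y].
have Sloc i x x' y : (forall j, olt j i -> x j = x' j) -> S i x y -> S i x' y.
  move=> xx' Sy j ji; have [xjy Zy] := Sy j ji; rewrite -xx' //; split=> // d.
  rewrite (_ : c j d x' = c j d x) //; apply/predeqP => a.
  have lt l : ole l j -> olt l i by move=> lj; exact: ole_lt_trans ji.
  by split=> -[l [Tl lj]]; [rewrite -xx'|rewrite xx'] => [?||?|]; try exact: lt;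
    exists l.
(* Taking the least admissible value makes the sequence continuous. All [d] are treated at once,
   because the right one is known only after [x] is complete. *)
pose R i x y := S i x y /\ forall z, S i x z -> ole y z.
have [i x x' y xx' [Sy ymin]|i x|x xP] := wf_choice (j0 l0) (R := R).
- split=> [|z Sz]; first exact: Sloc Sy.
  by apply: ymin; apply: Sloc Sz => j /xx'.
- have /choice[u uP] : forall j, exists y, forall d, olt (Z (c j d x)) y.
    by move=> j; exact: (bounding_card lb (fun d => Z (c j d x)) Mlambda).
  have [y yP] := bounding_card lb (fun j => omax (x j) (u j)) Mlambda.
  have [|z Sz zmin] := omin (P := S i x); last by exists z.
  exists y => j _; split; first exact: ole_lt_trans (omax_l _ _) (yP j).
  by move=> d; apply/oltW/(olt_trans (uP j d)); exact: ole_lt_trans (omax_r _ _) (yP j).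
have xN : normal x.
  split=> [i j ij|i _ ilim y yi]; first by case: (xP j) => /(_ i ij)[].
  have [_ xmin] := xP i.
  have /existsNP[j /not_implyP[ji nj]] : ~ S i x y by move=> /xmin/ole_nolt.
  have [xjy|/nolt yxj] := pselect (olt (x j) y); last by exists j.
  have [d /negP Zd] : exists d, ~ ole (Z (c j d x)) y.
    by apply: contrapT => nd; apply: nj; split=> // d;
       apply: contrapT => ?; apply: nd; exists d.
  have [l jl li] := ilim j ji; exists l => //.
  by apply: ole_trans (oltW Zd) _; have [/(_ j jl)[_]] := xP l; exact.
have [y [v yv]] := fsup x xN.
have [d [Tv T0 Tmax Tlarge]] := TP v.
(* At coordinates above [M] the inclusion in [b y] is exact by obedience; the remaining coordinates
   are negligible by [Kfull]. *)
have Jc j : Jlt K I lambda (c j d x `\` b y).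
  apply/Jlt_full; apply: fullS Kfull => a Ma [[l [Tl _ bl]]]; apply.
  apply: olt_le_trans bl _; apply: yv => //; [exact: T0|exact: Tv].
(* [n j] is the successor of [j] inside [T d]. The increment of [b (x (n j))] over [c j d x] is
   positive, and it is absorbed by [c k d x] for every later [k] in [T d]. *)
have /choice[n nP] : forall j, exists l, T d j ->
    [/\ T d l, olt j l & forall k, T d k -> olt j k -> ole l k].
  move=> j; have [Tj|nTj] := pselect (T d j); last by exists j.
  have [l Tl jl] := Tmax j Tj.
  have [|k [Tk jk] kmin] := omin (P := [set k | T d k /\ olt j k]); first by exists l.
  by exists k => _; split=> // k' Tk' jk'; exact: kmin.
apply: (saturated_disjoint I_ideal Isat thinf 
  (V := fun j => b (x (n j)) `\` c j d x) Tlarge).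
  move=> j Tj; have [Tn jn _] := nP j Tj.
  have [/(_ j jn)[_ /(_ d) Zn] _] := xP (n j).
  have nJ := ZP _ _ Zn (ex_intro _ y (Jc j)).
  by move=> Ij; apply: nJ; left.
have Vlt j k a : T d j -> T d k -> olt j k -> b (x (n j)) a -> c k d x a.
  by move=> Tj Tk jk ba; have [Tn _ nmin] := nP j Tj;
    exists (n j); split=> //; exact: nmin.
move=> j k Tj Tk [a [[bj ncj] [bk nck]]].
have [jk|//|kj] := olt_cases j k.
  by case: nck; exact: Vlt jk bj.
by case: ncj; exact: Vlt kj bk.
Qed.

(** The generator is the stable value of the sets where [f y] exceeds [g]. An ultrafilter of
    cofinality [lambda] contains one of these sets by universality, hence also the stable one. *)
Lemma generator : exists2 B, Jlt K I (succ lambda) B &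
  forall C, Jlt K I (succ lambda) C -> Jlt K I lambda (C `\` B).
Proof.
have [f fO fU] := exists_universal.
have [g gP] := seminormal fO.
have [y yP] := stabilization g fO.
exists [set a | olt (g a) (f y a)] => [|C /(Jlt_dominated I g) JC].
  apply/(Jlt_dominated I g) => D DI Dy; apply/(dominated_lt_succ g).
  apply: contrapT => nD; have [DU _] := DI; apply: (filter_not_empty D).
  by apply: filterS (filterI (gP D y DI nD) Dy) => a [/= /ole_nolt].
apply/(Jlt_dominated I g) => D DI DCy; apply: contrapT => nD.
have [DU _] := DI.
have DC : D C by apply: filterS DCy => a [].
have [z Dz] := fU D (conj DI nD) ((dominated_lt_succ g lambda D).1 (JC D DI DC)) g.
apply: nD; move: (yP z) => /(Jlt_dominated I g); apply=> //.
by apply: filterS (filterI Dz DCy) => a [? []].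
Qed.

End Generators.

(** * Cofinalities of individual ultraproducts, and the theorem *)

Section Pcf.
Variables (A : Type) (K : A -> cardinal).
Implicit Types (D : set (set A)) (g : product K).

Lemma cofinality_le (D : set (set A)) (l : cardinal) (T : Type) : UltraFilter D ->
  has_cofinality (@ultraproduct_lt A K D) l -> dominated K D T ->
  [set: l] #<= [set: T].
Proof.
move=> DU [_ lmin] DT.
have [m [[S Scof /card_eqPle[Sm _]] _] mmin] := exists_cofinality K DU.
exact: card_le_trans (lmin S Scof) (card_le_trans Sm (mmin T DT)).
Qed.

(** Fewer than [l] functions are bounded modulo [D], so a cofinal family can be made increasing. An
    unbounded part of the index set then yields a cofinal subfamily. *)
Lemma cofinality_bounding (D : set (set A)) (l : cardinal) (g0 : product K) :
  UltraFilter D -> has_cofinality (@ultraproduct_lt A K D) l -> bounding l.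
Proof.
move=> DU Dl; have [f fP] := cofinality_dominated g0 _ Dl.
pose R y (h : l -> product K) u := (forall a, ole (f y a) (u a)) /\
  forall z, olt z y -> D [set a | ole (h z a) (u a)].
have [y h h' u hh' [fu hu]|y h|F FP] := wf_choice g0 (R := R).
- by split=> // z zy; rewrite -hh' //; exact: hu.
- have [u uP] : exists u : product K,
      forall z, olt z y -> ~ D [set a | ole (u a) (h z a)].
    apply: contrapT => nu; have : dominated K D {z | olt z y}.
      exists (fun s => h (sval s)) => g; apply: contrapT => nz; apply: nu.
      by exists g => z zy Dz; apply: nz; exists (exist _ z zy).
    move=> /(cofinality_le DU Dl)/card_le_trans/(_ (card_le_sig _)).
    exact/negP/ole_initial.
  exists (fun a => omax (f y a) (u a)); split=> [a|z zy]; first exact: omax_l.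
  have /ultraC := uP z zy; apply: filterS => a /= /negP hu.
  exact: ole_trans (oltW hu) (omax_r _ _).
move=> T S h nlS; apply: contrapT => nb; apply: nlS.
apply: card_le_trans (card_le_sig S); apply: (cofinality_le DU Dl).
exists (fun s => F (h (sval s))) => g; have [y Dy] := fP g.
have [t St yt] : exists2 t, S t & ole y (h t).
  apply: contrapT => nt; apply: nb; exists y => t St; apply: contrapT => /nolt yt.
  by apply: nt; exists t.
exists (exist _ t St) => /=.
have Fyt : D [set a | ole (F y a) (F (h t) a)].
  have [->|yht] := ole_eqVlt yt; last by case: (FP (h t)) => _; exact.
  by apply: (filterS _ filterT) => a _; exact: ole_refl.
apply: filterS (filterI Dy Fyt) => a /= [gf FF].
exact: ole_trans gf (ole_trans ((FP y).1 a) FF).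
Qed.

Lemma principal_dominated D a (g0 : product K) :
  Filter D -> D [set a] -> dominated K D (K a).
Proof.
move=> DF Da; pose h (x : K a) : product K := fun b =>
  if pselect (a = b) is left e then eq_rect a (fun b => K b) x b e else g0 b.
have hE x : h x a = x.
  by rewrite /h; case: pselect => // e; rewrite (Prop_irrelevance e erefl).
exists h => g; exists (g a); apply: filterS Da => b /= ->.
by rewrite hE; exact: ole_refl.
Qed.

(** Only the coordinate [a] matters: too few functions are bounded there by some [x], and a [g] with
    value [x] at [a] escapes them. *)
Lemma principal_le D a (l : cardinal) (g0 : product K) :
  bounding (K a) -> ProperFilter D -> D [set a] -> dominated K D l -> cle (K a) l.
Proof.
move=> Kab DF Da [h hP]; apply: contrapT => nKl.
have [x xP] := bounding_card Kab (fun t => h t a) (ncle_clt nKl).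
pose g b := if pselect (a = b) is left e then eq_rect a (fun b => K b) x b e else g0 b.
have [t Dt] := hP g; have [b [/= -> +]] := filter_ex (filterI Da Dt).
rewrite /g; case: pselect => // e; rewrite (Prop_irrelevance e erefl) /=.
by move=> /ole_nolt; apply; exact: xP.
Qed.

End Pcf.

Theorem theorem3p2 (A : Type) (K : A -> cardinal) (I : set (set A))
  (K_inj : forall a b, ceq (K a) (K b) -> a = b)
  (K_regular : forall a, regular (K a))
  (K_nomax : forall a, exists b, clt (K a) (K b))
  (I_ideal : is_ideal I)
  (K_progressive : progressive K I)
  (lambda : cardinal) (lambda_pcf : pcf K I lambda) :
  exists B : set A,
    Jlt K I (succ lambda) = smallest (@is_ideal A) (Jlt K I lambda `|` [set B]).
Proof.
have [_ [theta [[th_reg Isat _] _] thK]] := K_progressive.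
have [D0 [D0U D0I] D0l] := lambda_pcf.
have Kb a : bounding (K a) := regular_bounding (K_regular a).
have Kinf a : infinite_set [set: K a] := (K_regular a).1.
have [g0 _] := product_inhabited Kinf.
have lb := cofinality_bounding g0 D0U D0l.
(* Every [C] in the larger ideal is covered by the union of [C] minus [B] and [B]. *)
suff [B JB Bgen] : exists2 B, Jlt K I (succ lambda) B &
    forall C, Jlt K I (succ lambda) C -> Jlt K I lambda (C `\` B).
  exists B; apply/seteqP; split=> [C JC M [[_ Msub MU] JM]|].
    apply: (Msub _ ((C `\` B) `|` B)); last first.
      by move=> a Ca; have [|] := pselect (B a); [right|left].
    by apply: MU; apply: JM; [left; exact: Bgen|right].
  apply: smallest_sub; first exact: Jlt_ideal.
  move=> C [/(Jlt_dominated I g0) JC|-> //]; apply/(Jlt_dominated I g0) => D DI DC.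
  apply/(dominated_lt_succ g0); have [m [ml _] Dm] := JC D DI DC.
  exact: dominated_le Dm.
have [a _] := filter_ex (filterT : D0 setT).
(* [K a0] and [K a1], the two least members, serve as [M1] and [M]. The second exists because there
   is no maximum. *)
have [_ [a0 ->] a0min] := cardinal_min
  (ex_intro (fun k => exists a, k = K a) _ (ex_intro _ a erefl)).
have [b b0] := K_nomax a0.
have [_ [a1 [a01 ->]] a1min] := cardinal_min
  (ex_intro (fun k => exists a, clt (K a0) (K a) /\ k = K a) _
    (ex_intro _ b (conj b0 erefl))).
have N a' : ~ clt (K a1) (K a') -> a' = a0 \/ a' = a1.
  move=> n1; have le1 : cle (K a') (K a1) by apply: contrapT => /ncle_clt.
  have [c0|n0] := pselect (clt (K a0) (K a')); [right|left].
    by apply: K_inj; apply/card_eqPle; split=> //; apply: a1min; exists a'.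
  apply: K_inj; apply/card_eqPle; split; last by apply: a0min; exists a'.
  by apply: contrapT => /ncle_clt.
have NP D : UltraFilter D -> ~ D [set a | clt (K a1) (K a)] ->
    exists2 a, D [set a] & cle (K a) (K a1).
  move=> DU /ultraC DN; have : D ([set a0] `|` [set a1]) by apply: filterS DN => ? /N.
  by move=> /ultraU[Da|Da];
    [exists a0 => //; exact: a01.1|exists a1 => //; exact: card_lexx].
have [Ml|Ml] := pselect (clt (K a1) lambda).
  apply: (generator I_ideal Isat (regular_bounding th_reg) th_reg.1 Kb Kinf thK lb
    (Kb a0) (Kinf a0) (Kb a1) (thK a0) a01 Ml).
  (* An ultrafilter not concentrated above [K a1] is principal, so its cofinality is at most [K a1],
     which is below [lambda]. *)
  move=> D [DI Dn]; have [DU _] := DI; apply: contrapT => /(NP D DU)[a' Da' a'M].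
  apply: Dn; exists (K a'); first exact: cle_clt_trans Ml.
  exact: principal_dominated.
have {}Ml : cle lambda (K a1) by apply: contrapT => /ncle_clt.
(* Here the generator has at most the two points [a0] and [a1]. *)
exists [set a | ~ clt (K a1) (K a) /\ cle (K a) lambda].
  apply/(Jlt_dominated I g0) => D DI DB; have [DU _] := DI.
  apply/(dominated_lt_succ g0).
  have [|a' Da' _] := NP D DU.
    move=> DN; apply: (filter_not_empty D).
    by apply: filterS (filterI DN DB) => ? [? []].
  have [_ [/= -> [_ a'l]]] := filter_ex (filterI Da' DB).
  apply: (dominated_le g0 a'l); exact: principal_dominated.
move=> C /(Jlt_dominated I g0) JC; apply/(Jlt_dominated I g0) => D DI DCB.
have [DU _] := DI.
have Dl : dominated K D lambda.
  by apply/(dominated_lt_succ g0); apply: JC => //; apply: filterS DCB => ? [].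
case: (pselect (D [set a | clt (K a1) (K a)])) => [DM|/(NP D DU)[a' Da' a'M]].
  (* Above [K a1], hence above [lambda], the [lambda] many functions of [h] have a pointwise bound,
     so they cannot be cofinal modulo [D]. *)
  have [h hP] := Dl; have [g gP] := product_sup Kb Kinf h.
  have [g' g'P] := product_succ Kb Kinf g.
  have [t Dt] := hP g'; have [c [/= cM gh]] := filter_ex (filterI DM Dt).
  case: (ole_nolt gh); apply: ole_lt_trans (g'P c); apply: gP.
  exact: cle_clt_trans cM.
have [_ [/= -> [_ nB]]] := filter_ex (filterI Da' DCB).
case: nB; split; last exact: principal_le Da' Dl.
by move=> /clt_ncle.
Qed.
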